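(* Let $p$ be a prime number, $F$ a field with $\operatorname{char}(F)=p$, $n$ a positive integer and $\ell\in\{1,\dots,n\}$. Then every collection of $1+\sum_{i=\ell}^n 2^{i-1}$ inseparably $n$-linked decomposable differential forms in $H_p^{n+1}(F)$ is also separably $\ell$-linked.
   Context: $\Omega_F^1$ is the $F$-vector space of absolute differential forms, generated by symbols $da$ ($a\in F$) subject to $d(a+b)=da+db$ and $d(ab)=a\,db+b\,da$; $\Omega_F^n=\bigwedge^n\Omega_F^1$, $\Omega_F^0=F$, and $d:\Omega_F^{n-1}\to\Omega_F^{n}$ is given by $d(a_0\,da_1\wedge\dots\wedge da_{n-1})=da_0\wedge da_1\wedge\dots\wedge da_{n-1}$. The Artin–Schreier map $\wp:\Omega_F^n\to\Omega_F^n/d\Omega_F^{n-1}$ is the group homomorphism with $\alpha\frac{d\beta_1}{\beta_1}\wedge\dots\wedge\frac{d\beta_n}{\beta_n}\mapsto(\alpha^p-\alpha)\frac{d\beta_1}{\beta_1}\wedge\dots\wedge\frac{d\beta_n}{\beta_n}$ for $\alpha\in F$, $\beta_i\in F^\times$, and $H_p^{n+1}(F)=\operatorname{coker}(\wp)$. An element of $H_p^{n+1}(F)$ is called decomposable if it can be written as (the class of) $\alpha\frac{d\beta_1}{\beta_1}\wedge\dots\wedge\frac{d\beta_n}{\beta_n}$ for some $\alpha\in F$ and $\beta_1,\dots,\beta_n\in F^\times$. A collection $\omega_1,\dots,\omega_s$ of decomposable differential forms in $H_p^{n+1}(F)$ is inseparably $\ell$-linked if they can be written as $\omega_i=\alpha_i\frac{d\beta_{i,1}}{\beta_{i,1}}\wedge\dots\wedge\frac{d\beta_{i,n}}{\beta_{i,n}}$,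 $i\in\{1,\dots,s\}$ (equalities in $H_p^{n+1}(F)$), such that $\beta_{1,k}=\dots=\beta_{s,k}$ for all $k\in\{1,\dots,\ell\}$. The collection is separably $\ell$-linked if they can be written in this way such that $\alpha_1=\dots=\alpha_s$ and $\beta_{1,k}=\dots=\beta_{s,k}$ for all $k\in\{1,\dots,\ell-1\}$. *)

(* Defs.v *)
From HB Require Import structures.
From mathcomp Require Import all_boot all_order all_algebra.
From mathcomp Require Import ring_quotient generic_quotient boolp.
From mathcomp Require Import freeg.

Set Implicit Arguments.
Unset Strict Implicit.
Unset Printing Implicit Defensive.

Import GRing.Theory.
Local Open Scope ring_scope.
Local Open Scope quotient_scope.

Section GeneratedSubgroup.
Variables (V : zmodType) (S : V -> Prop).

Definition zspan : {pred V} := fun v =>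
  `[< forall W : zmodClosed V, (forall x, S x -> x \in W) -> v \in W >].

Lemma zspan_zmod_closed : zmod_closed zspan.
Proof.
split=> [|x y /asboolP Sx /asboolP Sy]; first by apply/asboolP => W _; exact: rpred0.
by apply/asboolP => W SW; rewrite rpredB ?Sx ?Sy.
Qed.

HB.instance Definition _ := GRing.isZmodClosed.Build V zspan zspan_zmod_closed.

Lemma mem_zspan x : S x -> x \in zspan.
Proof. by move=> Sx; apply/asboolP => W; exact. Qed.

Lemma zspan_sub (W : zmodClosed V) :
  (forall x, S x -> x \in W) -> {subset zspan <= W}.
Proof. by move=> SW x /asboolP; exact. Qed.

End GeneratedSubgroup.

Section GeneratedSubspace.
Variables (R : pzRingType) (V : lmodType R) (S : V -> Prop).

Definition lspan : {pred V} := fun v =>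
  `[< forall W : submodClosed V, (forall x, S x -> x \in W) -> v \in W >].

Lemma lspan_submod_closed : submod_closed lspan.
Proof.
split=> [|a x y /asboolP Sx /asboolP Sy].
  by apply/asboolP => W _; exact: rpred0.
by apply/asboolP => W SW; rewrite rpredD ?rpredZ ?Sx ?Sy.
Qed.

HB.instance Definition _ :=
  GRing.isSubmodClosed.Build R V lspan lspan_submod_closed.

Lemma mem_lspan x : S x -> x \in lspan.
Proof. by move=> Sx; apply/asboolP => W; exact. Qed.

Lemma lspan_sub (W : submodClosed V) :
  (forall x, S x -> x \in W) -> {subset lspan <= W}.
Proof. by move=> SW x /asboolP; exact. Qed.

End GeneratedSubspace.

(* The quotient of V by the subspace generated by S. The library's quotient of a
   group by a subgroup is only a [zmodType]; [lquot] adds the scalar action. *)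
Section ModuleQuotient.
Variables (R : pzRingType) (V : lmodType R) (S : V -> Prop).
Local Notation W := (lspan S).

Definition lquot := Quotient.quot W.
HB.instance Definition _ := GRing.Zmodule.on lquot.

Definition lproj (v : V) : lquot := \pi_(Quotient.quot W) v.

Lemma lproj_surj (x : lquot) : exists v, x = lproj v.
Proof. by exists (repr (x : Quotient.quot W)); rewrite /lproj reprK. Qed.

Lemma lproj_eq x y : (lproj x = lproj y) <-> (x - y \in W).
Proof. by rewrite (Quotient.idealrBE W); split=> [/eqP|/eqP]. Qed.

Lemma lprojD : {morph lproj : x y / x + y}.
Proof. exact: raddfD. Qed.

Definition lscale (a : R) (x : lquot) : lquot :=
  lproj (a *: repr (x : Quotient.quot W)).

Lemma lscaleE a v : lscale a (lproj v) = lproj (a *: v).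
Proof.
apply/lproj_eq; rewrite -scalerBr rpredZ //.
by apply/lproj_eq; rewrite /lproj reprK.
Qed.

Lemma lscaleA a b x : lscale a (lscale b x) = lscale (a * b) x.
Proof. by have [v ->] := lproj_surj x; rewrite !lscaleE scalerA. Qed.

Lemma lscale1 : left_id 1 lscale.
Proof. by move=> x; have [v ->] := lproj_surj x; rewrite lscaleE scale1r. Qed.

Lemma lscaleDr : right_distributive lscale +%R.
Proof.
move=> a x y; have [v ->] := lproj_surj x; have [w ->] := lproj_surj y.
by rewrite -lprojD !lscaleE scalerDr lprojD.
Qed.

Lemma lscaleDl x : {morph lscale^~ x : a b / a + b}.
Proof.
by move=> a b; have [v ->] := lproj_surj x; rewrite !lscaleE scalerDl lprojD.
Qed.

HB.instance Definition _ := GRing.Zmodule_isLmodule.Build R lquot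
  lscaleA lscale1 lscaleDr lscaleDl.

Lemma lproj_is_linear : linear lproj.
Proof. by move=> a x y; rewrite lprojD -lscaleE. Qed.

HB.instance Definition _ := GRing.isLinear.Build R V lquot *:%R lproj
  lproj_is_linear.

End ModuleQuotient.

Section ExteriorPower.
Variables (F : fieldType) (V : lmodType F) (n : nat).

Definition upd (w : 'I_n -> V) (i : 'I_n) (x : V) : 'I_n -> V :=
  fun k => if k == i then x else w k.

Definition tensor_symbol (w : 'I_n -> V) : {freeg {ffun 'I_n -> V} / F} :=
  << [ffun k => w k] >>.

Inductive ext_relation : {freeg {ffun 'I_n -> V} / F} -> Prop :=
| ext_multilinear w i a x y :
    ext_relation (tensor_symbol (upd w i (a *: x + y))
                  - (a *: tensor_symbol (upd w i x) + tensor_symbol (upd w i y)))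
| ext_alternating w i j : i != j -> w i = w j ->
    ext_relation (tensor_symbol w).

Definition ext_power : lmodType F := lquot ext_relation.

Definition wedge (w : 'I_n -> V) : ext_power := lproj _ (tensor_symbol w).

Lemma wedge_upd w i a x y :
  wedge (upd w i (a *: x + y)) = a *: wedge (upd w i x) + wedge (upd w i y).
Proof.
rewrite /wedge -linearP; apply/lproj_eq; apply: mem_lspan.
exact: ext_multilinear.
Qed.

Lemma wedge_alt w i j : i != j -> w i = w j -> wedge w = 0.
Proof.
move=> neq_ij eq_w; rewrite /wedge -(linear0 (lproj ext_relation)).
by apply/lproj_eq; rewrite subr0; apply/mem_lspan/(ext_alternating neq_ij).
Qed.

Lemma upd_id w i : upd w i (w i) = w.
Proof. by apply/funext => k; rewrite /upd; case: eqP => // ->. Qed.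

Lemma wedge_updZ w i a x : wedge (upd w i (a *: x)) = a *: wedge (upd w i x).
Proof.
have wedge0: wedge (upd w i 0) = 0.
  have := wedge_upd w i 1 0 0; rewrite !scale1r addr0 => /eqP.
  by rewrite -subr_eq0 opprD addNKr oppr_eq0 => /eqP.
by rewrite -[a *: x]addr0 wedge_upd wedge0 addr0.
Qed.

Lemma wedgeZ (b : 'I_n -> F) w :
  wedge (fun i => b i *: w i) = (\prod_i b i) *: wedge w.
Proof.
pose f k (i : 'I_n) := if (i < k)%N then b i *: w i else w i.
suff fE k : (k <= n)%N ->
    wedge (f k) = (\prod_(i < n | (i < k)%N) b i) *: wedge w.
  have -> : \prod_i b i = \prod_(i < n | (i < n)%N) b i.
    by apply: eq_bigl => i; rewrite ltn_ord.
  rewrite -fE //; congr wedge; apply/funext => i.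
  by rewrite /f ltn_ord.
elim: k => [|k IHk] lt_kn.
  by rewrite big_pred0 // scale1r; congr wedge; apply/funext => i.
pose i0 := Ordinal lt_kn.
have -> : \prod_(i < n | (i < k.+1)%N) b i
          = b i0 * \prod_(i < n | (i < k)%N) b i.
  rewrite (bigD1 i0) //=; congr (_ * _); apply: eq_bigl => i.
  by rewrite ltnS [RHS]ltn_neqAle andbC.
rewrite -scalerA -(IHk (ltnW lt_kn)) -[f k](upd_id _ i0) -wedge_updZ.
congr wedge; apply/funext => i; rewrite /upd /f ltnS leq_eqVlt.
rewrite -(inj_eq val_inj) /=.
by case: eqP => [ik|//]; rewrite ltnn (_ : i0 = i) //; apply: val_inj.
Qed.

End ExteriorPower.

Section DifferentialForms.
Variable F : fieldType.

Inductive kahler_relation : {freeg F / F} -> Prop :=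
| kahler_add a b : kahler_relation (<< a + b >> - (<< a >> + << b >>))
| kahler_mul a b : kahler_relation (<< a * b >> - (a *: << b >> + b *: << a >>)).

Definition Omega1 : lmodType F := lquot kahler_relation.

Definition dF (a : F) : Omega1 := lproj _ << a >>.

Lemma dFD a b : dF (a + b) = dF a + dF b.
Proof.
by rewrite /dF -linearD; apply/lproj_eq/mem_lspan/kahler_add.
Qed.

Lemma dFM a b : dF (a * b) = a *: dF b + b *: dF a.
Proof.
by rewrite /dF -!linearZ -linearD; apply/lproj_eq/mem_lspan/kahler_mul.
Qed.

Definition dlog (b : F) : Omega1 := b^-1 *: dF b.

Lemma dF0 : dF 0 = 0.
Proof. by have := dFM 0 0; rewrite mul0r !scale0r addr0. Qed.

Lemma Omega1_ind (P : Omega1 -> Prop) :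
  P 0 -> (forall a b x, P x -> P (a *: dF b + x)) -> forall x, P x.
Proof.
move=> P0 PD x; have [v ->] := lproj_surj x.
rewrite -(freeg_sumE v); elim: (dom v) => [|b s IHs].
  by rewrite big_nil linear0.
rewrite big_cons linearD; set y := lproj _ (\sum_(_ <- _) _) in IHs *.
suff -> : << coeff b v *g b >> = coeff b v *: << b >> :> {freeg F / F}.
  by rewrite linearZ; exact: PD.
by apply/eqP/freeg_eqP => c; rewrite coeffZ !coeffU mul1r.
Qed.

Definition Omega (n : nat) : lmodType F := ext_power Omega1 n.

Definition log_form n (a : F) (b : 'I_n -> F) : Omega n :=
  a *: wedge (fun i => dlog (b i)).

Lemma Omega_gen n (W : zmodClosed (Omega n)) :
    (forall a b, (forall i, b i != 0) -> log_form a b \in W) ->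
  forall w, w \in W.
Proof.
move=> Wlog.
have Wexact c (a : 'I_n -> F) : c *: wedge (fun i => dF (a i)) \in W.
  have [/forallP a_n0 | ] := boolP [forall i, a i != 0].
    rewrite (_ : (fun i => _) = (fun i => a i *: dlog (a i))).
      by rewrite wedgeZ scalerA; exact: Wlog.
    by apply/funext => i; rewrite /dlog scalerA divff // scale1r.
  rewrite negb_forall => /existsP[i]; rewrite negbK => /eqP ai0.
  rewrite -(upd_id (fun i => dF (a i)) i) ai0 dF0 -(scale0r 0) wedge_updZ.
  by rewrite scale0r scaler0 rpred0.
have Wwedge k c (w : 'I_n -> Omega1) :
    (forall i : 'I_n, (k <= i)%N -> exists a, w i = dF a) -> c *: wedge w \in W.
  elim: k c w => [|k IHk] c w w_dF.
    have /choice[a /funext ->] i := w_dF i (leq0n i); exact: Wexact.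
  have [le_nk | lt_kn] := leqP n k.
    by apply: IHk => i /(leq_trans le_nk); rewrite leqNgt ltn_ord.
  rewrite -(upd_id w (Ordinal lt_kn)); move: (w _) => x.
  elim/Omega1_ind: x c => [c|a b x IHx c].
    by rewrite -(scale0r 0) wedge_updZ scale0r scaler0 rpred0.
  rewrite wedge_upd scalerDr rpredD // scalerA; apply: IHk => i le_ki.
  rewrite /upd; case: eqP => [_|/eqP]; first by exists b.
  by rewrite -val_eqE /= => ne_ik; apply: w_dF; rewrite ltn_neqAle eq_sym ne_ik.
move=> w; have [v ->] := lproj_surj w; rewrite -(freeg_sumE v).
elim: (dom v) => [|u s IHs]; first by rewrite big_nil linear0 rpred0.
rewrite big_cons linearD rpredD //.
rewrite (_ : << _ *g _ >> = coeff u v *: tensor_symbol u); last first.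
  apply/eqP/freeg_eqP => t; rewrite coeffZ !coeffU mul1r.
  by congr (_ * (_ == _)%:R); apply/ffunP => i; rewrite ffunE.
rewrite linearZ; apply: (Wwedge n) => i.
by rewrite leqNgt ltn_ord.
Qed.

(* d(Omega^(n-1)) for n > 0, and 0 for n = 0.  As d is additive and Omega^(n-1)
   is generated as a group by the a_0 da_1 /\ ... /\ da_(n-1), the image of d is
   the subgroup generated by the da_0 /\ ... /\ da_(n-1); see [exactP]. *)
Definition exact n : {pred Omega n} := zspan (fun w =>
  (0 < n)%N /\ exists a : 'I_n -> F, w = wedge (fun i => dF (a i))).
HB.instance Definition _ n := GRing.ZmodClosed.on (@exact n).

Definition fcons n (a0 : F) (a : 'I_n -> F) (i : 'I_n.+1) : F :=
  if unlift ord0 i is Some j then a j else a0.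

Lemma exactP n (d : {additive Omega n -> Omega n.+1}) :
    (forall a0 a, d (a0 *: wedge (fun i => dF (a i)))
                  = wedge (fun i => dF (fcons a0 a i))) ->
  forall w, w \in @exact n.+1 <-> exists v, w = d v.
Proof.
move=> dE w; split.
  pose W : {pred Omega n.+1} := fun w => `[< exists v, w = d v >].
  have Wzmod : zmod_closed W.
    split=> [|_ _ /asboolP[v ->] /asboolP[v' ->]]; apply/asboolP.
      by exists 0; rewrite raddf0.
    by exists (v - v'); rewrite raddfB.
  pose W' : zmodClosed (Omega n.+1) := HB.pack W
    (GRing.isZmodClosed.Build (Omega n.+1) W Wzmod).
  move=> /(zspan_sub (W := W')) Ww; apply/asboolP/Ww => _ [_ [a ->]].
  apply/asboolP; exists (a ord0 *: wedge (fun i => dF (a (fintype.lift ord0 i)))).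
  rewrite dE; congr wedge; apply/funext => i; rewrite /fcons.
  by case: unliftP => [j ->|->].
case=> v ->{w}.
pose W : {pred Omega n} := fun v => d v \in @exact n.+1.
have Wzmod : zmod_closed W.
  split=> [|x y Wx Wy]; rewrite unfold_in; first by rewrite raddf0 rpred0.
  by rewrite raddfB rpredB.
pose W' : zmodClosed (Omega n) := HB.pack W
  (GRing.isZmodClosed.Build (Omega n) W Wzmod).
apply: (Omega_gen (W := W')) => a b b_n0; rewrite unfold_in /= /log_form.
rewrite wedgeZ scalerA dE; apply: mem_zspan; split=> //.
by exists (fcons (a * \prod_i (b i)^-1) b).
Qed.

Definition Omega_mod_exact (n : nat) : zmodType := Quotient.quot (@exact n).

Definition mod_exact n (w : Omega n) : Omega_mod_exact n :=
  \pi_(Quotient.quot (@exact n)) w.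

(* The image of the Artin-Schreier map, which is additive and prescribed on the
   generators [log_form a b] of Omega^n; see [wp_imageP]. *)
Definition wp_image p n : {pred Omega_mod_exact n} := zspan (fun x =>
  exists (a : F) (b : 'I_n -> F),
    (forall i, b i != 0) /\ x = mod_exact (log_form (a ^+ p - a) b)).
HB.instance Definition _ p n := GRing.ZmodClosed.on (@wp_image p n).

Lemma wp_imageP p n (wp : {additive Omega n -> Omega_mod_exact n}) :
    (forall a b, (forall i, b i != 0) ->
      wp (log_form a b) = mod_exact (log_form (a ^+ p - a) b)) ->
  forall x, x \in @wp_image p n <-> exists w, x = wp w.
Proof.
move=> wpE x; split.
  pose W : {pred Omega_mod_exact n} := fun x => `[< exists w, x = wp w >].
  have Wzmod : zmod_closed W.
    split=> [|_ _ /asboolP[v ->] /asboolP[v' ->]]; apply/asboolP.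
      by exists 0; rewrite raddf0.
    by exists (v - v'); rewrite raddfB.
  pose W' : zmodClosed (Omega_mod_exact n) := HB.pack W
    (GRing.isZmodClosed.Build (Omega_mod_exact n) W Wzmod).
  move=> /(zspan_sub (W := W')) Wx; apply/asboolP/Wx => _ [a [b [b_n0 ->]]].
  by apply/asboolP; exists (log_form a b); rewrite wpE.
case=> w ->{x}.
pose W : {pred Omega n} := fun w => wp w \in @wp_image p n.
have Wzmod : zmod_closed W.
  split=> [|x y Wx Wy]; rewrite unfold_in; first by rewrite raddf0 rpred0.
  by rewrite raddfB rpredB.
pose W' : zmodClosed (Omega n) := HB.pack W
  (GRing.isZmodClosed.Build (Omega n) W Wzmod).
apply: (Omega_gen (W := W')) => a b b_n0; rewrite unfold_in /= wpE //.
by apply: mem_zspan; exists a, b.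
Qed.

(* [Hp p n] is H_p^(n+1)(F), the cokernel of the Artin-Schreier map. *)
Definition Hp (p n : nat) : zmodType := Quotient.quot (@wp_image p n).

Definition Hp_class p n (w : Omega n) : Hp p n :=
  \pi_(Quotient.quot (@wp_image p n)) (mod_exact w).

Definition decomposable p n (x : Hp p n) : Prop :=
  exists (a : F) (b : 'I_n -> F),
    (forall i, b i != 0) /\ x = Hp_class p (log_form a b).

(* Slots are numbered from 0, so the first l slots are the k < l. *)
Definition inseparably_linked p n s (l : nat) (x : 'I_s -> Hp p n) : Prop :=
  exists (a : 'I_s -> F) (b : 'I_s -> 'I_n -> F),
    [/\ forall i k, b i k != 0,
        forall i, x i = Hp_class p (log_form (a i) (b i))
      & forall k : 'I_n, (k < l)%N -> forall i j, b i k = b j k].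

Definition separably_linked p n s (l : nat) (x : 'I_s -> Hp p n) : Prop :=
  exists (a : 'I_s -> F) (b : 'I_s -> 'I_n -> F),
    [/\ forall i k, b i k != 0,
        forall i, x i = Hp_class p (log_form (a i) (b i)),
        forall i j, a i = a j
      & forall k : 'I_n, (k < l.-1)%N -> forall i j, b i k = b j k].

End DifferentialForms.

(* Main.v *)
(** Write the given classes as [alpha_i dlog beta_1 /\ ... /\ dlog beta_n], and for
    a set [e] of slots put [beta^e := prod_(k in e) beta_k].  There are exactly
    [sum_(l <= i <= n) 2^(i-1)] sets [e] meeting the slots [>= l], so every index
    [i] other than a base index [0] gets its own such set [e_i].  With
    [y_i := alpha_i + (alpha_i - alpha_0) / beta^(e_i)], all the classes can be
    written with the coefficient
      [A := alpha_0 + sum_(j != 0) beta^(e_j) y_j^p].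
    For [i = 0] this holds because the terms of the sum only add exact forms.
    For [i != 0], choose [k] in [e_i] with [k >= l], and put
      [M := alpha_i + y_i^p - y_i
            + sum_(j != i, k in e_j) beta^(e_j) / beta^(e_i) y_j^p].
    Replacing slot [k] by [M] kills the class with coefficient [alpha_i], since
    [alpha_i] may be traded for [M] and [M dlog M = dM].  So slot [k] can be
    changed into [beta^(e_i) M], after which [beta^(e_i) M] can be added to the
    coefficient, again because [f dlog f = df].  The choice of [y_i] makes the
    result equal to [A]. *)

Require Import Defs.
From mathcomp Require Import all_boot all_order all_algebra.
From mathcomp Require Import ring_quotient generic_quotient boolp ring.

Set Implicit Arguments.
Unset Strict Implicit.
Unset Printing Implicit Defensive.

Import GRing.Theory.
Local Open Scope ring_scope.
Local Open Scope quotient_scope.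

(** * Multilinear and alternating identities for wedges *)

Section Wedge.
Variables (F : fieldType) (V : lmodType F) (n : nat).
Implicit Types (w : 'I_n -> V) (i j : 'I_n).

Lemma wedge_upd0 w i : wedge (upd w i 0) = 0.
Proof. by rewrite -(scale0r 0) wedge_updZ scale0r. Qed.

Lemma wedge_updD w i x y :
  wedge (upd w i (x + y)) = wedge (upd w i x) + wedge (upd w i y).
Proof. by rewrite -[x]scale1r wedge_upd !scale1r. Qed.

(** Each term with [j != i] repeats [w j] in two slots, so alternation kills it. *)
Lemma wedge_upd_sum w i (c : 'I_n -> F) :
  wedge (upd w i (\sum_j c j *: w j)) = c i *: wedge w.
Proof.
transitivity (\sum_j wedge (upd w i (c j *: w j))).
  apply: (big_morph (fun x => wedge (upd w i x))); first exact: wedge_updD.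
  exact: wedge_upd0.
rewrite (bigD1 i) //= wedge_updZ upd_id big1 ?addr0 // => j ne_ji.
rewrite wedge_updZ (@wedge_alt _ _ _ _ i j) ?scaler0 1?eq_sym //.
by rewrite /upd eqxx (negPf ne_ji).
Qed.

End Wedge.

(** * Differentials, logarithmic differentials and exact forms *)

Section Differentials.
Variable F : fieldType.
Implicit Types a b t : F.

Lemma dF1 : dF (1 : F) = 0.
Proof.
have := dFM (1 : F) 1; rewrite mulr1 !scale1r => /eqP.
by rewrite -subr_eq0 opprD addNKr oppr_eq0 => /eqP.
Qed.

Lemma dlog1 : dlog (1 : F) = 0.
Proof. by rewrite /dlog dF1 scaler0. Qed.

Lemma dF_dlog a : a != 0 -> dF a = a *: dlog a.
Proof. by move=> a0; rewrite /dlog scalerA divff // scale1r. Qed.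

Lemma dlogM a b : a != 0 -> b != 0 -> dlog (a * b) = dlog a + dlog b.
Proof.
move=> a0 b0; rewrite /dlog dFM scalerDr !scalerA addrC.
by congr (_ *: _ + _ *: _); field; rewrite a0 b0.
Qed.

Lemma dlogV a : a != 0 -> dlog a^-1 = - dlog a.
Proof.
move=> a0; apply/eqP; rewrite -addr_eq0 -dlogM ?invr_eq0 //.
by rewrite mulVf // dlog1.
Qed.

Lemma dlog_prod (I : finType) (A : {pred I}) (b : I -> F) :
  (forall i, b i != 0) ->
  dlog (\prod_(i in A) b i) = \sum_i (i \in A)%:R *: dlog (b i).
Proof.
move=> b0; rewrite [RHS](bigID (mem A)) /= [X in _ + X]big1 ?addr0; last first.
  by move=> i /negPf ->; rewrite scale0r.
rewrite [RHS](eq_bigr (fun i => dlog (b i))); last by move=> i ->; rewrite scale1r.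
pose P x (y : Omega1 F) := x != 0 /\ dlog x = y.
suff [] : P (\prod_(i in A) b i) (\sum_(i in A) dlog (b i)) by [].
apply: (big_rec2 P) => [|i x y _ [y0 <-]]; first by split; rewrite ?oner_eq0 ?dlog1.
by split; rewrite ?mulf_neq0 // dlogM.
Qed.

Lemma dFX t m : dF (t ^+ m) = (m%:R * t ^+ m.-1) *: dF t.
Proof.
elim: m => [|m IHm]; first by rewrite mul0r scale0r dF1.
rewrite exprS dFM IHm scalerA -scalerDl; congr (_ *: _).
by case: m {IHm} => [|m] /=; rewrite ?exprS; ring.
Qed.

(** In characteristic [p], a [p]-th power is a constant for [dF]. *)
Lemma dF_mulpX p a t : p \in [pchar F] -> dF (a * t ^+ p) = t ^+ p *: dF a.
Proof.
by move=> charF; rewrite dFM dFX (pcharf0 charF) mul0r scale0r scaler0 add0r.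
Qed.

(* The [b i]^-1, i != j, can be pulled into [dF f]: their product [C] only
   contributes to [dF (C * f)] a combination of the other slots. *)
Lemma exact_upd n (b : 'I_n -> F) (j : 'I_n) (f : F) :
  (forall i, b i != 0) ->
  wedge (upd (fun i => dlog (b i)) j (dF f)) \in @exact F n.
Proof.
move=> b0; pose B := \prod_(i in predC1 j) b i; pose C := B^-1.
have B0 : B != 0 by apply/prodf_neq0.
have dC : dF C = \sum_i (- C * (i != j)%:R * (b i)^-1) *: dF (b i).
  rewrite dF_dlog ?invr_eq0 // dlogV // dlog_prod // scalerN -scaleNr scaler_sumr.
  by apply: eq_bigr => i _; rewrite /dlog !scalerA inE.
suff -> : wedge (upd (fun i => dlog (b i)) j (dF f)) =
          wedge (fun i => dF ([eta b with j |-> C * f] i)).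
  by apply: mem_zspan; split; [case: n j {b b0 B C B0 dC} => // [[]] | eexists].
rewrite [fun i => dF _](_ : _ = upd (fun i => dF (b i)) j (C *: dF f + f *: dF C));
  last first.
  by apply/funext => i; rewrite /upd /=; case: eqP => // _; rewrite dFM.
rewrite wedge_updD !wedge_updZ dC (wedge_upd_sum (fun i => dF (b i))) eqxx.
rewrite mulr0 mul0r scale0r scaler0 addr0.
rewrite [X in wedge X](_ : _ = fun i =>
  (if i == j then 1 else (b i)^-1) *: upd (fun i => dF (b i)) j (dF f) i).
  rewrite wedgeZ; congr (_ *: _); rewrite (bigD1 j) //= eqxx mul1r /C /B.
  by rewrite -prodfV; apply: eq_bigr => i /negPf ->.
by apply/funext => i; rewrite /upd; case: eqP => _; rewrite ?scale1r.
Qed.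

End Differentials.

(** * Calculus of symbols in the cokernel *)

Section Symbols.
Variables (F : fieldType) (p : nat) (n : nat).
Hypothesis charF : p \in [pchar F].
Implicit Types (a t u : F) (b : 'I_n -> F) (j k : 'I_n).

Definition symbol a b : Hp F p n := Hp_class p (log_form a b).

Lemma Hp_classD (v w : Omega F n) :
  Hp_class p (v + w) = Hp_class p v + Hp_class p w.
Proof. by rewrite /Hp_class /mod_exact !raddfD. Qed.

Lemma Hp_class_exact (w : Omega F n) : w \in @exact F n -> Hp_class p w = 0.
Proof.
move=> exw; rewrite /Hp_class; suff -> : mod_exact w = 0 by rewrite raddf0.
rewrite -(raddf0 (\pi_(Quotient.quot (@exact F n)))); apply/eqP.
by rewrite -(Quotient.idealrBE (@exact F n)) subr0.
Qed.

Lemma symbolD a a' b : symbol (a + a') b = symbol a b + symbol a' b.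
Proof. by rewrite /symbol /log_form scalerDl Hp_classD. Qed.

Lemma symbol0 b : symbol 0 b = 0.
Proof. by rewrite /symbol /log_form scale0r Hp_class_exact ?rpred0. Qed.

Lemma symbolN a b : symbol (- a) b = - symbol a b.
Proof. by apply/eqP; rewrite -addr_eq0 -symbolD addNr symbol0. Qed.

Lemma symbol_sum0 (I : finType) (P : pred I) (f : I -> F) b :
  (forall i, P i -> symbol (f i) b = 0) -> symbol (\sum_(i | P i) f i) b = 0.
Proof.
move=> f0; apply: (big_ind (fun a => symbol a b = 0)) => //.
  exact: symbol0.
by move=> x y x0 y0; rewrite symbolD x0 y0 addr0.
Qed.

Lemma symbol_wp t b : (forall i, b i != 0) -> symbol (t ^+ p - t) b = 0.
Proof.
move=> b0; rewrite /symbol /Hp_class.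
rewrite -(raddf0 (\pi_(Quotient.quot (@wp_image F p n)))); apply/eqP.
rewrite -(Quotient.idealrBE (@wp_image F p n)) subr0.
by apply: mem_zspan; exists t, b.
Qed.

Lemma log_form_upd a b k u :
  log_form a [eta b with k |-> u]
  = a *: wedge (upd (fun i => dlog (b i)) k (dlog u)).
Proof.
congr (_ *: wedge _); apply/funext => i.
by rewrite /upd /=; case: eqP.
Qed.

Lemma symbol_updM a b k u v : u != 0 -> v != 0 ->
  symbol a [eta b with k |-> u * v]
  = symbol a [eta b with k |-> u] + symbol a [eta b with k |-> v].
Proof.
move=> u0 v0; rewrite /symbol !log_form_upd dlogM // wedge_updD scalerDr.
exact: Hp_classD.
Qed.

Lemma symbol_upd1 a b k : symbol a [eta b with k |-> 1] = 0.
Proof.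
by rewrite /symbol log_form_upd dlog1 wedge_upd0 scaler0 Hp_class_exact ?rpred0.
Qed.

Lemma symbol_upd_dlog a b k u (c : 'I_n -> F) :
  dlog u = \sum_i c i *: dlog (b i) -> c k = 1 ->
  symbol a [eta b with k |-> u] = symbol a b.
Proof.
move=> du ck; rewrite /symbol log_form_upd du.
by rewrite (wedge_upd_sum (fun i => dlog (b i))) ck scale1r.
Qed.

(** Up to the sign [c j], slot [j] may carry [dlog u]; then [u * t ^+ p] turns it into
    [dF (u * t ^+ p)], and the form is exact. *)
Lemma symbol_exact b u t (c : 'I_n -> F) j :
  (forall i, b i != 0) -> u != 0 ->
  dlog u = \sum_i c i *: dlog (b i) -> c j \in [:: 1; -1] ->
  symbol (u * t ^+ p) b = 0.
Proof.
move=> b0 u0 du cj.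
have exu : u * t ^+ p *: wedge (upd (fun i => dlog (b i)) j (dlog u))
           \in @exact F n.
  rewrite -wedge_updZ mulrC -scalerA -dF_dlog // -dF_mulpX //.
  exact: exact_upd.
apply: Hp_class_exact; move: exu.
rewrite du (wedge_upd_sum (fun i => dlog (b i))) /log_form.
move: cj; rewrite !inE => /orP[] /eqP ->; first by rewrite scale1r.
by rewrite scaleN1r scalerN rpredN.
Qed.

Lemma symbol_diag b k u : (forall i, b i != 0) -> u != 0 ->
  symbol u [eta b with k |-> u] = 0.
Proof.
move=> b0 u0; rewrite -[X in symbol X _]mulr1 -(expr1n F p).
apply: (@symbol_exact _ _ _ (fun i => (i == k)%:R) k) => //=.
- by move=> i; case: ifP.
- rewrite (bigD1 k) //= eqxx scale1r big1 ?addr0 // => i /negPf ->.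
  by rewrite scale0r.
- by rewrite eqxx inE eqxx.
Qed.

End Symbols.

(** * Rewriting all classes with one common coefficient *)

Section Linkage.
Variables (F : fieldType) (p n : nat).
Hypothesis charF : p \in [pchar F].
Variable b : 'I_n -> F.
Hypothesis b0 : forall i, b i != 0.
Implicit Types (e : {set 'I_n}) (k : 'I_n) (t v : F).

Let mon e := \prod_(i in e) b i.

Let mon_neq0 e : mon e != 0.
Proof. exact/prodf_neq0. Qed.

Let symbol_mon e t : e != set0 -> symbol p (mon e * t ^+ p) b = 0.
Proof.
case/set0Pn => j je; apply: (symbol_exact charF t (c := fun i => (i \in e)%:R) (j := j)) => //.
  exact: dlog_prod.
by rewrite je inE eqxx.
Qed.

(* For [e' = set0] this is about [mon e] itself. *)
Let symbol_upd_mon e e' k t v :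
  v != 0 -> e != e' -> (k \in e) = (k \in e') ->
  symbol p (mon e / mon e' * t ^+ p) [eta b with k |-> v] = 0.
Proof.
(* [c i] is the exponent of [b i] in [mon e / mon e']. Since [c k = 0], the entry in slot [k] is
   irrelevant. *)
move=> v0 ne_e eq_k; pose c i : F := (i \in e)%:R - (i \in e')%:R.
have [j ne_j] : exists j, (j \in e) != (j \in e').
  apply/existsP; apply: contraR ne_e; rewrite negb_exists => /forallP eq_e.
  by apply/eqP/setP => j; apply/eqP; rewrite -[_ == _]negbK.
apply: (symbol_exact charF t (c := c) (j := j)) => //=.
- by move=> i; case: ifP.
- by rewrite mulf_neq0 ?invr_eq0.
- rewrite dlogM ?invr_eq0 // dlogV // !dlog_prod // -sumrB.
  apply: eq_bigr => i _; rewrite -scalerBl -/(c i).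
  by case: eqP => // ->; rewrite /c eq_k subrr !scale0r.
- by rewrite /c !inE; move: ne_j; do 2!case: (j \in _); rewrite ?subr0 ?sub0r ?eqxx ?orbT.
Qed.

Let symbol_upd_mon0 e k t v : v != 0 -> e != set0 -> k \notin e ->
  symbol p (mon e * t ^+ p) [eta b with k |-> v] = 0.
Proof.
move=> v0 ne_e k_e; have := @symbol_upd_mon e set0 k t v v0 ne_e.
rewrite {2}/mon big_set0 divr1; apply; rewrite inE; exact: negPf.
Qed.

Variables (I : finType) (i0 : I) (g : I -> {set 'I_n}) (a : I -> F).
Hypotheses (g_inj : injective g) (g0 : forall i, i != i0 -> g i != set0).

Let y i := a i + (a i - a i0) / mon (g i).

Definition common_coef : F :=
  a i0 + \sum_(i | i != i0) mon (g i) * y i ^+ p.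

Lemma symbol_common_coef0 : symbol p (a i0) b = symbol p common_coef b.
Proof.
rewrite symbolD symbol_sum0 ?addr0 // => i ne_i.
exact/symbol_mon/g0.
Qed.

Lemma symbol_common_coef i k : i != i0 -> k \in g i ->
  exists2 v, v != 0 & symbol p (a i) b = symbol p common_coef [eta b with k |-> v].
Proof.
move=> ne_i k_gi; set u := mon (g i).
have u0 : u != 0 by exact: mon_neq0.
(* [S0] gathers the monomials free of [b k], which vanish whatever slot [k] contains. The terms of
   [S1] do too, as [b k] cancels in each ratio and [g] is injective. *)
pose S0 := \sum_(j | (j != i0) && (k \notin g j)) mon (g j) * y j ^+ p.
pose S1 := \sum_(j | [&& j != i0, k \in g j & j != i])
             mon (g j) / u * y j ^+ p.
pose M := a i + (y i ^+ p - y i) + S1.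
have coefE : common_coef = a i + S0 + u * M.
  have S1u : u * S1 = \sum_(j | [&& j != i0, k \in g j & j != i])
                         mon (g j) * y j ^+ p.
    by rewrite mulr_sumr; apply: eq_bigr => j _; field; exact: u0.
  rewrite /common_coef (bigID (fun j => k \in g j)) /= -/S0.
  rewrite (bigD1 i) /=; last by rewrite ne_i.
  rewrite (eq_bigl (fun j => [&& j != i0, k \in g j & j != i])) => [|j];
    last by rewrite andbA.
  rewrite -S1u -/u /M.
  (* The term [- u * y i] in [u * M] thus cancels [u * a i] and trades [a i] for [a i0]. *)
  have yE : u * y i = u * a i + (a i - a i0) by rewrite /y -/u; field; exact: u0.
  have -> : u * (a i + (y i ^+ p - y i) + S1)
            = u * a i + u * y i ^+ p - u * y i + u * S1 by ring.
  rewrite yE; ring.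
have aE : a i = M - (y i ^+ p - y i) - S1 by rewrite /M; ring.
have S1b v : v != 0 -> symbol p S1 [eta b with k |-> v] = 0.
  move=> v0; apply: symbol_sum0 => j /and3P[_ k_gj ne_ji].
  by apply: symbol_upd_mon; rewrite ?(inj_eq g_inj) // k_gj.
have upd_b0 v : v != 0 -> forall j, [eta b with k |-> v] j != 0.
  by move=> v0 j /=; case: ifP.
have a_upd v : v != 0 ->
    symbol p (a i) [eta b with k |-> v] = symbol p M [eta b with k |-> v].
  move=> v0; rewrite aE !symbolD !symbolN S1b // symbol_wp ?subr0 //.
  exact: upd_b0.
have bE : [eta b with k |-> b k] = b :> ('I_n -> F).
  by apply/funext => j /=; case: eqP => [->|].
(* If [M = 0], the class itself is zero, and the entry [1] makes the right side zero as well. *)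
have [M0|M0] := eqVneq M 0.
  exists 1; first exact: oner_neq0.
  by rewrite symbol_upd1 -{1}bE a_upd // M0 symbol0.
exists (u * M); first by rewrite mulf_neq0.
rewrite coefE symbolD symbol_diag // ?mulf_neq0 // addr0 symbol_updM //.
have S0_upd v : v != 0 -> symbol p S0 [eta b with k |-> v] = 0.
  move=> v0; apply: symbol_sum0 => j /andP[ne_j k_gj].
  by apply: symbol_upd_mon0 => //; exact: g0.
rewrite !symbolD !S0_upd // !addr0 (a_upd M) // symbol_diag // addr0.
(* Only the factor [b k] of [u] matters in slot [k]; the others repeat existing slots. *)
rewrite (symbol_upd_dlog _ _ (c := fun j => (j \in g i)%:R)) ?k_gi //.
exact: dlog_prod.
Qed.

End Linkage.

(** * Counting the exponent sets and assembling the linkage *)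

(** Both sides equal [2 ^ n - 2 ^ l], the right one as a geometric sum. *)
Lemma card_subsets_meeting_tail (n l : nat) : (l <= n)%N ->
  #|~: powerset [set k : 'I_n | (k < l)%N]| = (\sum_(l.+1 <= i < n.+1) 2 ^ (i - 1))%N.
Proof.
move=> le_ln; have card_l : #|[set k : 'I_n | (k < l)%N]| = l.
  rewrite -sum1_card (eq_bigl (fun k : 'I_n => (k < l)%N)); last by move=> k; rewrite inE.
  by rewrite (big_ord_narrow le_ln) /= sum1_card card_ord.
have := cardsC (powerset [set k : 'I_n | (k < l)%N]).
rewrite card_powerset card_l -cardsT -powersetT card_powerset cardsT card_ord => cardE.
apply/eqP; rewrite -(eqn_add2l (2 ^ l)) cardE {cardE card_l}; apply/eqP.
elim: n le_ln => [|n IHn]; first by rewrite leqn0 => /eqP ->; rewrite big_geq.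
rewrite leq_eqVlt => /predU1P[->|le_ln]; first by rewrite big_geq // addn0.
by rewrite big_nat_recr //= addnA -IHn // subn1 expnS mul2n addnn.
Qed.

Theorem theorem6p1 (p : nat) (F : fieldType) (hp : prime p)
    (charF : p \in [pchar F]%R) (n : nat) (hn : (0 < n)%N)
    (l : nat) (hl1 : (1 <= l)%N) (hln : (l <= n)%N)
    (x : 'I_(1 + \sum_(l <= i < n.+1) 2 ^ (i - 1)) -> Hp F p n) :
  (forall i, decomposable (x i)) ->
  inseparably_linked n x -> separably_linked l x.
Proof.
move=> _ [a [b [b0 xE b_eq]]].
(* From here [l] is the predecessor: the slots to be shared are exactly those [k < l]. *)
case: l hl1 hln x a b b0 xE b_eq => // l _ lt_ln.
rewrite -(card_subsets_meeting_tail (ltnW lt_ln)).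
set E := ~: _ => x a b b0 xE b_eq.
pose i0 : 'I_(1 + #|E|) := ord0.
(* The other indices enumerate [E]; the base index gets [set0], which is outside [E], so [g] stays
   injective. *)
pose g (i : 'I_(1 + #|E|)) : {set 'I_n} :=
  if unlift i0 i is Some j then enum_val j else set0.
have gE i : i != i0 -> g i \in E.
  by rewrite /g; case: unliftP => [j _ _|->]; rewrite ?eqxx ?enum_valP.
have set0E : set0 \notin E by rewrite !inE sub0set.
have g0 i : i != i0 -> g i != set0.
  by move=> /gE; apply: contraTneq => ->.
have gi0 : g i0 = set0 by rewrite /g unlift_none.
have g_inj : injective g.
  move=> i j; have [->|ne_i] := eqVneq i i0; have [->|ne_j] := eqVneq j i0 => //.
  - by rewrite gi0 => /esym/eqP; rewrite (negPf (g0 _ ne_j)).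
  - by rewrite gi0 => /eqP; rewrite (negPf (g0 _ ne_i)).
  rewrite /g; case: (unliftP i0 i) ne_i => [? -> _|->]; last by rewrite eqxx.
  case: (unliftP i0 j) ne_j => [? -> _|->]; last by rewrite eqxx.
  by move=> eq_v; rewrite (enum_val_inj eq_v).
have bE i : b i = b i0.
  by apply/funext => k; apply: b_eq.
pose A := common_coef p (b i0) i0 g a.
suff /choice[c cP] i : exists c : 'I_n -> F,
    [/\ forall k, c k != 0, x i = Hp_class p (log_form A c)
      & forall k : 'I_n, (k < l)%N -> c k = b i0 k].
  exists (fun=> A), c; split=> // [i k|i|k lt_kl i j].
  - by case: (cP i).
  - by case: (cP i).
  - by have [_ _ ciE] := cP i; have [_ _ cjE] := cP j; rewrite ciE ?cjE.
rewrite xE bE.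
have [-> | ne_i] := eqVneq i i0.
  exists (b i0); split=> //.
  exact: (symbol_common_coef0 charF (b0 i0) a g0).
(* Since [g i] is in [E], it has a slot [k >= l], whose change leaves the shared slots intact. *)
have := gE i ne_i; rewrite !inE => /subsetPn[k k_gi]; rewrite inE -leqNgt => le_lk.
have [v v0 aiE] := symbol_common_coef charF (b0 i0) a g_inj g0 ne_i k_gi.
exists [eta b i0 with k |-> v]; split=> [j||j lt_jl] //=.
- by case: ifP.
- by case: eqP => // jk; move: le_lk; rewrite -jk leqNgt lt_jl.
Qed.
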